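(* Let $S$ be a subgroup of a countable amenable group $G$ with identity $e$, and let $H\subseteq S\setminus\{e\}$. Then $H$ is a vdC set in $S$ if and only if it is a vdC set in $G$.
   Context: A countable group $G$ is (left) amenable if it has a (left) Følner sequence, i.e. a sequence $(F_N)_{N\in\mathbb{N}}$ of (nonempty) finite subsets of $G$ such that $\lim_{N\to\infty}\frac{|gF_N\Delta F_N|}{|F_N|}=0$ for all $g\in G$. A measure preserving system $(X,\mathcal{B},\mu,(T_g)_{g\in G})$ is a probability space $(X,\mathcal{B},\mu)$ together with an action $(T_g)_{g\in G}$ of $G$ on $X$ by measure preserving maps (so $T_g\circ T_h=T_{gh}$). For a countable group $\Gamma$ with identity $e$, a set $H\subseteq \Gamma\setminus\{e\}$ is a vdC set in $\Gamma$ if for every measure preserving system $(X,\mathcal{B},\mu,(T_g)_{g\in \Gamma})$ and every (complex valued) $f\in L^\infty(\mu)$: if $\int_{X}f(T_hx)\overline{f(x)}\,d\mu(x)=0$ for all $h\in H$, then $\int_{X}f\,d\mu=0$. *)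

(* Defs.v *)
From HB Require Import structures.
From mathcomp Require Import all_boot all_order all_algebra.
From mathcomp Require Import finmap complex.
From mathcomp Require Import all_classical all_reals all_analysis.

Set Implicit Arguments.
Unset Strict Implicit.
Unset Printing Implicit Defensive.

Import Order.TTheory GRing.Theory Num.Theory.
Import numFieldNormedType.Exports.

Local Open Scope classical_set_scope.
Local Open Scope ring_scope.

Definition symdiff (K : choiceType) (A B : {fset K}) : {fset K} :=
  ((A `\` B) `|` (B `\` A))%fset.

Definition folner_sequence (R : realType) (G : groupType)
    (F : nat -> {fset G}) : Prop :=
  (forall N, F N != fset0) /\
  forall g : G,
    (fun N => #|` symdiff [fset (g * x)%g | x in F N]%fset (F N) |%:R
              / #|` F N |%:R : R) @ \oo --> (0 : R).

Definition amenable (R : realType) (G : groupType) : Prop :=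
  exists F : nat -> {fset G}, folner_sequence R F.

Record measure_preserving_action (R : realType) (G : groupType)
    (d : measure_display) (X : measurableType d) (mu : probability X R)
    (T : G -> X -> X) : Prop := {
  mpa_measurable : forall g, measurable_fun [set: X] (T g) ;
  mpa_preserving : forall g (A : set X),
    measurable A -> mu (T g @^-1` A) = mu A ;
  mpa_one : forall x, T 1%g x = x ;
  mpa_mul : forall g h x, T (g * h)%g x = T g (T h x)
}.

Section ComplexFunctions.
Context (R : realType) (d : measure_display) (X : measurableType d).
Implicit Types (mu : probability X R) (f : X -> R[i]).

(* R[i] carries no sigma-algebra in the library; this is measurability for the
   Borel sigma-algebra of C = R^2. *)
Definition cmeasurable f : Prop :=
  measurable_fun [set: X] (fun x => complex.Re (f x)) /\
  measurable_fun [set: X] (fun x => complex.Im (f x)).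

Definition cLinfty mu f : Prop :=
  cmeasurable f /\ finite_norm mu +oo%E (fun x => ComplexField.Normc.normc (f x)).

(* Rintegral is 0 on non-integrable functions; here it is only applied to
   bounded (up to a null set) measurable functions on a probability space. *)
Definition cintegral mu f : R[i] :=
  Complex (\int[mu]_x complex.Re (f x)) (\int[mu]_x complex.Im (f x)).

End ComplexFunctions.

Definition vdC_set (R : realType) (Gamma : groupType) (H : set Gamma) : Prop :=
  H `<=` ~` [set 1%g] /\
  forall (d : measure_display) (X : measurableType d) (mu : probability X R)
         (T : Gamma -> X -> X) (f : X -> R[i]),
    measure_preserving_action mu T ->
    cLinfty mu f ->
    (forall h, H h -> cintegral mu (fun x => f (T h x) * conjc (f x)) = 0) ->
    cintegral mu f = 0.

(* Main.v *)
Require Import Defs.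
From HB Require Import structures.
From mathcomp Require Import all_boot all_order all_algebra.
From mathcomp Require Import finmap complex.
From mathcomp Require Import all_classical all_reals all_analysis.
From mathcomp Require Import measurable_realfun ess_sup_inf.

(** Restricting a [G]-action to [S] shows that vdC sets of [S] are vdC sets of
    [G]. Conversely, given an action [T] of [S] on [(X, mu)], consider the
    coinduced action: [G] acts by left translation on the maps [phi : G -> X]
    with [phi (g s) = T s^-1 (phi g)]. Such a map is determined by its values on
    coset representatives, so these maps form [X^(G/S)], and the product measure
    is invariant because a translation permutes the coordinates and applies
    measure preserving maps to them. Evaluation at [1] is an [S]-equivariant
    factor map onto [X], so it carries the correlations along [H] and the
    integral of [f] to those of its lift.

    The infinite product measure is obtained by Caratheodory extension from the
    algebra of cylinders. For continuity at the empty set: if the measures of a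
    decreasing sequence of cylinders do not tend to [0], dominated convergence
    yields an [x] whose sections have the same property; iterating produces a
    point of the intersection. *)

Set Implicit Arguments.
Unset Strict Implicit.
Unset Printing Implicit Defensive.

Import Order.TTheory GRing.Theory Num.Theory.
Import numFieldNormedType.Exports.

Local Open Scope classical_set_scope.
Local Open Scope ring_scope.

(** * Infinite product measures *)

Section power_space.
Context (K : Type) {d : measure_display} (X : measurableType d).

Definition coordinate_sets : set (set (K -> X)) :=
  [set A | exists k, exists2 B, measurable B & A = (fun y => y k) @^-1` B].

Local Notation power_space := (g_sigma_algebraType coordinate_sets).

Lemma measurable_coordinate (k : K) :
  measurable_fun [set: power_space] (fun y : power_space => y k).
Proof.
move=> _ B mB; rewrite setTI; apply: sub_sigma_algebra.
by exists k, B.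
Qed.

Lemma measurable_fun_power {d'} (Z : measurableType d') (f : Z -> power_space) :
  (forall k, measurable_fun [set: Z] (fun z => f z k)) ->
  measurable_fun [set: Z] f.
Proof.
move=> mf; apply: (@measurability _ _ Z power_space _ _ coordinate_sets) => //.
by move=> _ [_ [k [B mB ->]] <-]; exact: (mf k).
Qed.

End power_space.

Notation power_space K X := (g_sigma_algebraType (@coordinate_sets K _ X)).

(** * Sequences and their cylinders *)

Section sequence_space.
Context {d : measure_display} {X : measurableType d}.
Local Notation Y := (power_space nat X).
Implicit Types A B : set Y.

Definition scons (x : X) (y : Y) : Y := fun n => if n is n'.+1 then y n' else x.

Definition scons_pair (p : X * Y) : Y := scons p.1 p.2.

Lemma measurable_scons_pair : measurable_fun [set: X * Y] scons_pair.
Proof.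
apply: measurable_fun_power => -[|k] /=; first exact: measurable_fst.
exact: measurableT_comp (measurable_coordinate _) measurable_snd.
Qed.

HB.instance Definition _ :=
  isMeasurableFun.Build _ _ _ _ scons_pair measurable_scons_pair.

Definition depends_below (n : nat) A : Prop :=
  forall y z, (forall i, (i < n)%N -> y i = z i) -> A y -> A z.

Definition cylinder A : Prop := measurable A /\ exists n, depends_below n A.

Lemma depends_belowW m n A :
  (m <= n)%N -> depends_below m A -> depends_below n A.
Proof. by move=> mn Am y z yz; apply: Am => i im; apply/yz/(leq_trans im). Qed.

Lemma depends_below0 A : depends_below 0 A -> A = set0 \/ A = setT.
Proof.
move=> A0; have [->|/set0P[y Ay]] := eqVneq A set0; first by left.
by right; apply/seteqP; split=> // z _; exact: (A0 y).
Qed.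

Lemma depends_below_scons n A x :
  depends_below n.+1 A -> depends_below n (scons x @^-1` A).
Proof. by move=> An y z yz; apply: An => -[|i] //; exact: yz. Qed.

Lemma measurable_scons x : measurable_fun [set: Y] (scons x).
Proof. exact: measurable_fun_pair2 measurable_scons_pair. Qed.

Lemma measurable_preimage_scons A x :
  measurable A -> measurable (scons x @^-1` A).
Proof.
by move=> mA; rewrite -[X in measurable X]setTI; exact: measurable_scons.
Qed.

Lemma cylinder_scons A x : cylinder A -> cylinder (scons x @^-1` A).
Proof.
move=> [mA [n An]]; split; first exact: measurable_preimage_scons.
by exists n; apply: depends_below_scons; exact: depends_belowW An.
Qed.

Lemma cylinder0 : cylinder set0.
Proof. by split; [exact: measurable0|exists 0%N]. Qed.

Lemma cylinderC A : cylinder A -> cylinder (~` A).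
Proof.
move=> [mA [n An]]; split; first exact: measurableC.
by exists n => y z yz nAy Az; apply: nAy; apply: An Az => i /yz.
Qed.

Lemma cylinderU A B : cylinder A -> cylinder B -> cylinder (A `|` B).
Proof.
move=> [mA [m Am]] [mB [n Bn]]; split; first exact: measurableU.
exists (maxn m n) => y z yz [Ay|By]; [left|right].
  by apply: Am Ay => i im; apply: yz; rewrite leq_max im.
by apply: Bn By => i im; apply: yz; rewrite leq_max im orbT.
Qed.

End sequence_space.

(* [cylinder_space X] carries the algebra of cylinders, [power_space nat X] the
   sigma-algebra generated by the coordinates. *)
Definition cylinder_space {d} (X : measurableType d) : Type := nat -> X.

HB.instance Definition _ {d} (X : measurableType d) :=
  Pointed.on (cylinder_space X).
HB.instance Definition _ {d} (X : measurableType d) :=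
  @isAlgebraOfSets.Build default_measure_display (cylinder_space X)
    (@cylinder d X) cylinder0 cylinderU cylinderC.

(** * The product measure on sequences *)

Section infinite_product.
Context {d : measure_display} {X : measurableType d} {R : realType}.
Variable mu : probability X R.
Local Notation Y := (power_space nat X).
Implicit Types A B : set Y.

(* The law of [(x_0, ..., x_(n-1), point, point, ...)] with i.i.d. [x_i]. *)
Fixpoint product_approx (n : nat) : probability Y R :=
  if n is n'.+1 then
    distribution (mu \x product_approx n')%E
      (scons_pair : {mfun (X * Y)%type >-> Y})
  else \d_(point : Y).

Lemma product_approxS n A :
  measurable A ->
  product_approx n.+1 A =
  (\int[mu]_x product_approx n (scons x @^-1` A))%E.
Proof.
move=> mA; apply: eq_integral => x _ /=.
by congr (product_approx n _); rewrite xsectionE.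
Qed.

Lemma measurable_fun_product_approx n A :
  measurable A ->
  measurable_fun [set: X] (fun x => product_approx n (scons x @^-1` A) ).
Proof.
move=> mA.
have mpA : measurable (scons_pair @^-1` A).
  by rewrite -[X in measurable X]setTI; exact: measurable_scons_pair.
have := measurable_fun_xsection (product_approx n) mpA.
apply: eq_measurable_fun => x _ /=.
by congr (product_approx n _); rewrite xsectionE.
Qed.

(** Peeling off the first coordinate reduces to sets that depend on no coordinate. These are empty
    or everything, and all probabilities agree on them. *)
Lemma product_approx_stable n k A :
  measurable A -> depends_below n A ->
  product_approx (n + k) A = product_approx n A.
Proof.
elim: n A => [|n IH] A mA An.
  by have [->|->] := depends_below0 An; rewrite ?measure0// !probability_setT.
rewrite addSn !product_approxS//; apply: eq_integral => x _.
by apply: IH; [exact: measurable_preimage_scons|exact: depends_below_scons].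
Qed.

(** The bound [n] is an arbitrary choice, with default [0] for sets that have none;
    [product_contentE] shows that the choice is immaterial on cylinders. *)
Definition product_content A : \bar R :=
  product_approx (xget 0%N [set n | depends_below n A]) A.

(** Two bounds [m] and [n] for the same set are compared through [m + n], by stability on either
    side. *)
Lemma product_contentE n A :
  measurable A -> depends_below n A -> product_content A = product_approx n A.
Proof.
move=> mA An; rewrite /product_content.
have := @xgetI _ 0%N [set n | depends_below n A] n An.
set m := xget _ _ => /= Am.
by rewrite -(product_approx_stable n mA Am) addnC product_approx_stable.
Qed.

Lemma product_content_scons A :
  cylinder A ->
  product_content A = (\int[mu]_x product_content (scons x @^-1` A))%E.
Proof.
move=> [mA [n An]].
(* Raising the bound to [n.+1] leaves a coordinate to integrate over even when [n] is [0]. *)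
have An1 := depends_belowW (leqnSn n) An.
rewrite (product_contentE mA An1) product_approxS//; apply: eq_integral => x _.
rewrite (@product_contentE n)//; first exact: measurable_preimage_scons.
exact: depends_below_scons.
Qed.

Lemma measurable_fun_product_content A : cylinder A ->
  measurable_fun [set: X] (fun x => product_content (scons x @^-1` A) : \bar R).
Proof.
move=> [mA [n An]].
have An1 := depends_belowW (leqnSn n) An.
have := measurable_fun_product_approx n mA.
apply: eq_measurable_fun => x _ /=.
rewrite (@product_contentE n)//; first exact: measurable_preimage_scons.
exact: depends_below_scons.
Qed.

Local Open Scope ereal_scope.

Lemma product_content0 : product_content set0 = 0.
Proof. exact: measure0. Qed.

Lemma product_content_ge0 A : 0 <= product_content A.
Proof. exact: measure_ge0. Qed.

Lemma product_content_le1 A : cylinder A -> product_content A <= 1.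
Proof. by move=> [mA _]; exact: probability_le1. Qed.

Lemma product_contentT : product_content setT = 1.
Proof. exact: probability_setT. Qed.

Lemma product_contentU A B :
  cylinder A -> cylinder B -> A `&` B = set0 ->
  product_content (A `|` B) = product_content A + product_content B.
Proof.
move=> [mA [m Am]] [mB [n Bn]] AB0.
have Amn := depends_belowW (leq_maxl m n) Am.
have Bmn := depends_belowW (leq_maxr m n) Bn.
rewrite !(@product_contentE (maxn m n))//; last 2 first.
- exact: measurableU.
- by move=> y z yz [Ay|By]; [left; exact: Amn Ay|right; exact: Bmn By].
by rewrite measureU.
Qed.

(* If no section of [A] carried mass in the limit, dominated convergence would
   make the mass of [A] itself vanish. *)
Lemma section_with_mass (A : nat -> set Y) :
  (forall n, cylinder (A n)) ->
  ~ (product_content (A n) @[n --> \oo] --> 0) ->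
  exists x, ~ (product_content (scons x @^-1` A n) @[n --> \oo] --> 0).
Proof.
move=> cA An0; apply: contrapT => noex; apply: An0.
have sec0 x : product_content (scons x @^-1` A n) @[n --> \oo] --> 0.
  by apply: contrapT => h; apply: noex; exists x.
rewrite [X in X @ _](_ : _ = fun n =>
    \int[mu]_x product_content (scons x @^-1` A n)); last first.
  by apply/funext => n; exact: product_content_scons.
rewrite -(integral0 mu setT).
apply: (@dominated_cvg _ _ _ mu setT measurableT _ _ (cst 1)) => //.
- by move=> n; exact: measurable_fun_product_content.
- by move=> x _; exact: sec0.
- exact: finite_measure_integrable_cst.
- move=> n x _; rewrite gee0_abs ?product_content_ge0//.
  exact/product_content_le1/cylinder_scons.
Qed.

Definition prefix (x : nat -> X) (n : nat) (y : Y) : Y :=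
  fun i => if (i < n)%N then x i else y (i - n)%N.

Lemma prefix0 x y : prefix x 0 y = y.
Proof. by apply/funext => i; rewrite /prefix ltn0 subn0. Qed.

Lemma prefix_scons x n y : prefix x n (scons (x n) y) = prefix x n.+1 y.
Proof.
apply/funext => i; rewrite /prefix ltnS; case: (ltngtP i n) => [//| |->].
- by move=> ni; rewrite subnS -subn_gt0 in ni *; case: (i - n)%N ni.
- by rewrite subnn.
Qed.

Lemma nonincreasing_vanishing (A : nat -> set Y) m :
  (forall n, cylinder (A n)) -> nonincreasing_seq A -> A m = set0 ->
  product_content (A n) @[n --> \oo] --> 0.
Proof.
move=> cA decA Am0; apply: cvg_near_cst; near=> n.
have mn : (m <= n)%N by near: n; exact: nbhs_infty_ge.
rewrite (_ : A n = set0) ?product_content0//.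
by rewrite -subset0 -Am0; exact/subsetPset/decA.
Unshelve. all: by end_near. Qed.

Lemma product_content_continuous (A : nat -> set Y) :
  (forall n, cylinder (A n)) -> nonincreasing_seq A ->
  \bigcap_n A n = set0 -> product_content (A n) @[n --> \oo] --> 0.
Proof.
move=> cA decA capA; apply: contrapT => An0.
pose massive (B : nat -> set Y) :=
  [/\ forall n, cylinder (B n), nonincreasing_seq B &
      ~ (product_content (B n) @[n --> \oo] --> 0)].
(* Taking sections at the point given by [section_with_mass] preserves all three properties; [cid]
   makes this a function that can be iterated. *)
have step (B : {B | massive B}) :
    {x : X | massive (fun n => scons x @^-1` (sval B) n)}.
  case: B => B [cB decB B0] /=; apply/cid.
  have [x xB] := section_with_mass cB B0; exists x; split=> //.
  - by move=> n; exact: cylinder_scons.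
  - move=> n p np; apply/subsetPset; apply: preimage_subset.
    exact/subsetPset/decB.
pose next (B : {B | massive B}) : {B | massive B} :=
  exist massive (fun n => scons (sval (step B)) @^-1` sval B n)
    (svalP (step B)).
have massA : massive A by [].
pose Bseq n := iter n next (exist _ A massA).
pose x n := sval (step (Bseq n)).
(* After [n] rounds the sets are the sections of the original ones at the first [n] chosen
   points. *)
have BseqE n k : sval (Bseq n) k = prefix x n @^-1` A k.
  elim: n => [|n IH].
    by rewrite (_ : prefix x 0 = id)//; apply/funext => y; exact: prefix0.
  rewrite [LHS]/= IH; apply/funext => y /=.
  by rewrite prefix_scons.
suff : (\bigcap_n A n) x by rewrite capA.
(* [A n] sees only the first [N] coordinates, so it contains [x] once it contains some point that
   starts like [x] up to there. Such a point exists because the sections of round [N] keep their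
   mass and hence are nonempty. *)
move=> n _; have [_ [N AnN]] := cA n.
have [cB decB B0] := svalP (Bseq N).
have /set0P[y] : sval (Bseq N) n != set0.
  by apply/negP => /eqP Bn0; apply: B0; exact: nonincreasing_vanishing Bn0.
by rewrite BseqE; apply: AnN => i iN; rewrite /prefix iN.
Qed.

Definition cylinder_content (A : set (cylinder_space X)) : \bar R :=
  product_content A.

Let cylinder_content_semi_additive :
  measure_function.semi_additive cylinder_content.
Proof.
apply/(additive2P (mu := cylinder_content) product_content0).
move=> A B cA cB AB0.
exact: product_contentU.
Qed.

HB.instance Definition _ := isContent.Build _ (cylinder_space X) R
  cylinder_content product_content_ge0 cylinder_content_semi_additive.

(** The union [U] is itself a cylinder, so the remainders [U] minus [V n] are cylinders decreasing
    to the empty set. By continuity there their contents tend to [0], and since these are finite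
    they can be subtracted from that of [U]. *)
Let cylinder_content_semi_sigma_additive : semi_sigma_additive cylinder_content.
Proof.
move=> F mF tF mU.
set U := \bigcup_n F n.
pose V n := \big[setU/set0]_(i < n) F i.
have mV n : measurable (V n) by exact: bigsetU_measurable.
have mUV n : measurable (U `\` V n) by exact: measurableD.
have VU n : V n `<=` U by rewrite /V -bigcup_mkord => y [i _ Fy]; exists i.
have UE n : cylinder_content U =
    cylinder_content (V n) + cylinder_content (U `\` V n).
  rewrite -{1}(setDUK (VU n)); apply: product_contentU; [exact: mV|exact: mUV|].
  by rewrite setDE setIC -setIA setICl setI0.
have finUV n : cylinder_content (U `\` V n) \is a fin_num.
  rewrite ge0_fin_numE ?product_content_ge0//.
  by rewrite (le_lt_trans (product_content_le1 (mUV n)))// ltry.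
rewrite (_ : (fun n => _) =
    (fun n => cylinder_content U - cylinder_content (U `\` V n))); last first.
  apply/funext => n.
  rewrite big_mkord -(cylinder_content_semi_additive mF tF (mV n)).
  by rewrite (UE n) addeK.
rewrite -[X in _ --> X]sube0; apply: cvgeB.
- by rewrite fin_num_adde_defl.
- exact: cvg_cst.
apply: product_content_continuous => //.
- move=> m n mn; apply/subsetPset => y [Uy Vny]; split=> // Vmy; apply: Vny.
  move: Vmy; rewrite /V -!bigcup_mkord => -[i /= im Fy].
  by exists i => //=; exact: leq_trans mn.
- rewrite -subset0 => y UVy; have [[i _ Fiy] _] := UVy 0%N I.
  have [_ nVy] := UVy i.+1 I; apply: nVy; rewrite /V -bigcup_mkord.
  by exists i => /=.
Qed.

HB.instance Definition _ := Content_isMeasure.Build _ (cylinder_space X) R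
  cylinder_content cylinder_content_semi_sigma_additive.

Local Notation cylinder_sigma :=
  (g_sigma_algebraType (@measurable _ (cylinder_space X))).

Definition cylinder_measure : set cylinder_sigma -> \bar R :=
  measure_extension cylinder_content.

HB.instance Definition _ := Measure.on cylinder_measure.

Let cylinder_measureE (A : set (cylinder_space X)) :
  measurable A -> cylinder_measure A = product_content A.
Proof.
by move=> mA; rewrite /cylinder_measure /measure_extension measurable_mu_extE.
Qed.

Let cylinder_measureT : cylinder_measure setT = 1.
Proof. by rewrite cylinder_measureE ?product_contentT. Qed.

HB.instance Definition _ :=
  Measure_isProbability.Build _ _ _ cylinder_measure cylinder_measureT.

(** Coordinate sets are cylinders, so the identity is measurable and carries the extended measure to
    the sigma-algebra generated by the coordinates. *)
Definition from_cylinders : cylinder_sigma -> Y := id.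

Let measurable_from_cylinders :
  measurable_fun [set: cylinder_sigma] from_cylinders.
Proof.
apply: measurable_fun_power => k _ B mB; rewrite setTI.
apply: sub_sigma_algebra; split.
  by rewrite -[X in measurable X]setTI; exact: measurable_coordinate.
by exists k.+1 => y z yz; rewrite /preimage/= /from_cylinders yz.
Qed.

HB.instance Definition _ :=
  isMeasurableFun.Build _ _ _ _ from_cylinders measurable_from_cylinders.

Definition sequence_probability : probability Y R :=
  distribution cylinder_measure from_cylinders.

Lemma sequence_probabilityE A :
  cylinder A -> sequence_probability A = product_content A.
Proof. by move=> cA; exact: cylinder_measureE. Qed.

End infinite_product.

(** * Finite rectangles as a generating pi-system *)

Section rectangles.
Context {K : choiceType} {d : measure_display} {X : measurableType d}.
Implicit Types (s : seq K) (B : K -> set X).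
Local Notation power_space := (power_space K X).

Definition rectangle s B : set power_space :=
  [set y | forall k, k \in s -> B k (y k)].

Lemma measurable_rectangle s B :
  (forall k, measurable (B k)) -> measurable (rectangle s B).
Proof.
move=> mB.
have -> : rectangle s B =
    \bigcap_(k in [set` s]) ((fun y : power_space => y k) @^-1` B k).
  by apply/seteqP; split => y sBy k /sBy.
rewrite bigcap_seq; apply: bigsetI_measurable => k _.
by rewrite -[X in measurable X]setTI; exact: measurable_coordinate.
Qed.

Definition rectangles : set (set power_space) :=
  [set A | exists s B,
     [/\ uniq s, forall k, measurable (B k) & A = rectangle s B]].

Lemma rectanglesI : setI_closed rectangles.
Proof.
move=> _ _ [s [B [_ mB ->]]] [t [C [_ mC ->]]].
(* Each family is padded with [setT] outside its own index list, so that both can be read over the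
   merged list. *)
exists (undup (s ++ t)), (fun k =>
  (if k \in s then B k else setT) `&` (if k \in t then C k else setT)).
split; first exact: undup_uniq.
  by move=> k; apply: measurableI; case: ifP.
apply/seteqP; split=> y /=.
  by move=> [sBy tCy] k _; split; case: ifPn => // kst; [exact: sBy|exact: tCy].
move=> stBC; split=> k ks; have := stBC k; rewrite mem_undup mem_cat ks ?orbT/=;
by case/(_ erefl).
Qed.

Lemma measurable_rectanglesE : @measurable _ power_space = <<s rectangles >>.
Proof.
apply/seteqP; split; last first.
  apply: smallest_sub; first exact: smallest_sigma_algebra.
  by move=> _ [s [B [_ mB ->]]]; exact: measurable_rectangle.
apply: smallest_sub; first exact: smallest_sigma_algebra.
move=> _ [k [B mB ->]]; apply: sub_sigma_algebra.
exists [:: k], (fun _ => B); split=> //.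
apply/seteqP; split=> y /=; first by move=> Byk j; rewrite inE => /eqP ->.
by apply; rewrite mem_head.
Qed.

(** Uniqueness of measures on a generating pi-system; the whole space is the rectangle over the
    empty list. *)
Lemma eq_on_rectangles {R : realType} (P Q : probability power_space R) :
  (forall s B, uniq s -> (forall k, measurable (B k)) ->
    P (rectangle s B) = Q (rectangle s B)) ->
  forall A, measurable A -> P A = Q A.
Proof.
move=> PQ A mA.
apply: (measure_unique rectangles (fun=> setT)) => //.
- exact: measurable_rectanglesE.
- exact: rectanglesI.
- move=> _; exists [::], (fun=> setT); split=> //.
  by apply/seteqP; split.
- by rewrite bigcup_const//; exists 0%N.
- by move=> _ [s [B [us mB ->]]]; exact: PQ.
- by move=> _ /=; rewrite probability_setT ltry.
Qed.

End rectangles.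

(** * Products over a countable index set *)

Section countable_power.
Context {d : measure_display} {X : measurableType d} {R : realType}.
Variable mu : probability X R.
Local Open Scope ereal_scope.

Lemma rectangle_iota n (A : nat -> set X) :
  rectangle (iota 0 n) A = [set y | forall i, (i < n)%N -> A i (y i)].
Proof.
apply/seteqP; split=> y yA i; [move=> ni|rewrite mem_iota => /andP[_ ni]];
  by apply: yA => //; rewrite mem_iota.
Qed.

Lemma product_approx_box n (A : nat -> set X) :
  (forall i, measurable (A i)) ->
  product_approx mu n (rectangle (iota 0 n) A) = \prod_(i < n) mu (A i).
Proof.
elim: n A => [|n IH] A mA.
  rewrite big_ord0 (_ : rectangle _ _ = setT) ?probability_setT//.
  by apply/seteqP; split.
rewrite product_approxS; last exact: measurable_rectangle.
rewrite big_ord_recl -[\prod_(i < n) _](IH (fun i => A i.+1))//.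
(* The first factor becomes the integral of an indicator. This matches the left side: the section at
   [x] is the shifted box if [x] lies in [A 0], and empty otherwise. *)
rewrite -[in RHS](setIT (A 0%N)).
rewrite -integral_indic// -ge0_integralZr//; last exact/measurable_EFinP.
apply: eq_integral => x _; rewrite indicE.
have [xA0|xA0] := boolP (x \in A 0%N).
  rewrite mul1e; congr (product_approx mu n _).
  rewrite !rectangle_iota; apply/seteqP; split=> y yA.
    by move=> i; exact: (yA i.+1).
  by case=> [_|i ni]; [rewrite inE in xA0|exact: yA].
rewrite mul0e (_ : _ @^-1` _ = set0) ?measure0//.
rewrite -subset0 rectangle_iota => y /(_ 0%N erefl) A0x.
by rewrite notin_setE in xA0.
Qed.

(** The sequence measure is pushed forward along the selection of the coordinates [e k]. Natural
    numbers outside the image of [e] contribute only factors [mu setT = 1]. *)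
Lemma infinite_product (K : choiceType) (e : K -> nat) : injective e ->
  exists P : probability (power_space K X) R,
    forall (s : seq K) (B : K -> set X),
      uniq s -> (forall k, measurable (B k)) ->
      P (rectangle s B) = \prod_(k <- s) mu (B k).
Proof.
move=> e_inj.
pose reindex (y : power_space nat X) : power_space K X := fun k => y (e k).
have mreindex : measurable_fun setT reindex.
  by apply: measurable_fun_power => k; exact: measurable_coordinate.
pose reindexM := HB.pack_for {mfun power_space nat X >-> power_space K X} reindex
  (isMeasurableFun.Build _ _ _ _ reindex mreindex).
exists (distribution (sequence_probability mu) reindexM) => s B us mB.
(* At most one [k] is involved, by injectivity; an empty intersection gives [setT], that is, no
   constraint on coordinate [i]. *)
pose A i := \bigcap_(k in [set k | k \in s /\ e k = i]) B k.
have Ae k : k \in s -> A (e k) = B k.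
  move=> ks; apply/seteqP; split=> x; first by apply.
  by move=> Bx j [_ /e_inj ->].
have An i : i \notin map e s -> A i = setT.
  move=> nsi; apply/seteqP; split=> // x _ k [ks eki].
  by move: nsi; rewrite -eki map_f.
have mA i : measurable (A i).
  have [/mapP[k ks ->]|/An -> //] := boolP (i \in map e s).
  by rewrite Ae.
have [n en] : exists n, forall k, k \in s -> (e k < n)%N.
  exists (\max_(k <- s) e k).+1 => k ks.
  by rewrite ltnS (big_rem k)//= leq_maxl.
have dep : depends_below n (rectangle (iota 0 n) A).
  by rewrite rectangle_iota => y z yz yA i ni; rewrite -yz//; exact: yA.
have mrect : measurable (rectangle (iota 0 n) A) by exact: measurable_rectangle.
transitivity (sequence_probability mu (rectangle (iota 0 n) A)).
  congr (sequence_probability mu _); rewrite rectangle_iota.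
  apply/seteqP; split=> y yA.
    move=> i _; have [/mapP[k ks ->]|/An -> //] := boolP (i \in map e s).
    by rewrite Ae//; exact: yA.
  by move=> k ks; rewrite -(Ae k ks); apply: yA; exact: en.
rewrite sequence_probabilityE; last by split=> //; exists n.
rewrite (product_contentE mu mrect dep) product_approx_box//.
rewrite -(big_mkord xpredT (fun i => mu (A i))).
rewrite (bigID (mem (map e s)))/= [X in _ * X]big1 ?mule1; last first.
  by move=> i /An ->; exact: probability_setT.
rewrite -big_filter (perm_big (map e s))/=; last first.
  apply: uniq_perm; [by rewrite filter_uniq ?iota_uniq|by rewrite map_inj_uniq|].
  move=> i; rewrite mem_filter mem_index_iota /=.
  by case: (boolP (i \in map e s)) => //= /mapP[k ks ->]; rewrite en.
by rewrite big_map; apply: eq_big_seq => k ks; rewrite Ae.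
Qed.

End countable_power.

(** * Factor maps *)

Lemma cmeasurable_comp {d d'} {Y : measurableType d} {X : measurableType d'}
    {R : realType} (f : X -> R[i]) (p : Y -> X) :
  cmeasurable f -> measurable_fun [set: Y] p -> cmeasurable (fun y => f (p y)).
Proof.
by move=> [mRe mIm] mp; split;
  [exact: measurableT_comp mRe mp|exact: measurableT_comp mIm mp].
Qed.

Section factor_map.
Context {d d'} {Y : measurableType d} {X : measurableType d'} {R : realType}.
Variables (P : probability Y R) (mu : probability X R) (p : Y -> X).
Hypothesis measurable_p : measurable_fun [set: Y] p.
Hypothesis preserving_p : forall A, measurable A -> P (p @^-1` A) = mu A.

Let pM := HB.pack_for {mfun Y >-> X} p
  (isMeasurableFun.Build _ _ _ _ p measurable_p).

Lemma integral_factor (g : X -> \bar R) : measurable_fun [set: X] g ->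
  (\int[P]_y g (p y) = \int[mu]_x g x)%E.
Proof.
have ge0_factor (h : X -> \bar R) : measurable_fun [set: X] h ->
    (forall x, 0 <= h x)%E -> (\int[P]_y h (p y) = \int[mu]_x h x)%E.
  move=> mh h0.
  rewrite -[LHS](@ge0_integral_distribution _ _ _ _ _ P pM h mh h0).
  by apply: eq_measure_integral => A mA _; exact: preserving_p.
move=> mg; rewrite integralE [RHS]integralE; congr (_ - _)%E.
- rewrite -ge0_factor//; last exact: measurable_funepos.
  by apply: eq_integral => y _; rewrite funepos.unlock.
- rewrite -ge0_factor//; last exact: measurable_funeneg.
  by apply: eq_integral => y _; rewrite funeneg.unlock.
Qed.

Lemma cintegral_factor (f : X -> R[i]) : cmeasurable f ->
  cintegral P (fun y => f (p y)) = cintegral mu f.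
Proof.
move=> [mRe mIm]; rewrite /cintegral; congr (Complex (fine _) (fine _)).
  by apply: (integral_factor (g := EFin \o _)); exact/measurable_EFinP.
by apply: (integral_factor (g := EFin \o _)); exact/measurable_EFinP.
Qed.

Lemma cLinfty_factor (f : X -> R[i]) :
  cLinfty mu f -> cLinfty P (fun y => f (p y)).
Proof.
move=> [cf foo]; split; first exact: cmeasurable_comp.
(* The norm at [+oo] is the essential supremum when the total mass is positive, as it is here on
   both spaces. The null set for [f] then pulls back to one for the lift. *)
move: foo; rewrite /finite_norm unlock /= !probability_setT lte01 => foo.
apply: le_lt_trans foo; apply/ess_supP.
have [N [mN N0 subN]] :=
  ess_sup_ge mu (abse \o (EFin \o (fun x => ComplexField.Normc.normc (f x)))).
exists (p @^-1` N); split.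
- by rewrite -[X in measurable X]setTI; exact: measurable_p.
- exact: etrans (preserving_p mN) N0.
- by move=> y yN; apply: subN => /= fy; exact: yN.
Qed.

End factor_map.

Lemma cmeasurable_mul_conj {d} {X : measurableType d} {R : realType}
    (f g : X -> R[i]) :
  cmeasurable f -> cmeasurable g -> cmeasurable (fun x => f x * conjc (g x)).
Proof.
move=> [mRef mImf] [mReg mImg]; split.
- apply: (eq_measurable_fun (fun x =>
    complex.Re (f x) * complex.Re (g x) + complex.Im (f x) * complex.Im (g x))).
    by move=> x _; case: (f x) => a b; case: (g x) => a' b' /=;
      rewrite mulrN opprK.
  by apply: measurable_funD; exact: measurable_funM.
- apply: (eq_measurable_fun (fun x =>
    complex.Im (f x) * complex.Re (g x) - complex.Re (f x) * complex.Im (g x))).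
    by move=> x _; case: (f x) => a b; case: (g x) => a' b' /=;
      rewrite mulrN addrC.
  by apply: measurable_funB; exact: measurable_funM.
Qed.

(** * The coinduced action *)

Section coinduction.
Local Open Scope group_scope.
Context (G : groupType) (Pr : {pred G}) (S : subGroupType Pr).
Implicit Types (g h : G) (s : S).

Let mem_val s : val s \in Pr. Proof. exact: valP. Qed.

Let val_of g : g \in Pr -> exists s : S, val s = g.
Proof. by move=> gP; exists (Sub g gP); rewrite SubK. Qed.

Lemma val_invg s : val s^-1 = (val s)^-1.
Proof. exact: gmulfV. Qed.

(** The set is the left coset of [g]. The choice made by [xget] depends on this set alone, hence is
    constant on cosets. *)
Definition coset_rep g : G := xget 1 [set k | g^-1 * k \in Pr].

Lemma coset_rep_in g : g^-1 * coset_rep g \in Pr.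
Proof.
apply: (@xgetPex _ 1 [set k | g^-1 * k \in Pr]); exists g.
by rewrite /= mulVg -(val1 S) mem_val.
Qed.

Lemma coset_rep_mul g s : coset_rep (g * val s) = coset_rep g.
Proof.
congr xget; apply/seteqP; split=> k /=; rewrite invgM -val_invg.
  move=> /val_of[t tE]; rewrite -[g^-1 * k](mulVKg (val s)).
  by rewrite -val_invg [val s^-1 * _]mulgA -tE -valM mem_val.
by move=> /val_of[t tE]; rewrite -mulgA -tE -valM mem_val.
Qed.

Lemma coset_part_in g : (coset_rep g)^-1 * g \in Pr.
Proof.
have [s sE] := val_of (coset_rep_in g).
by rewrite -[_ * g]invgK invgM invgK -sE -val_invg mem_val.
Qed.

Definition coset_part g : S := insubd 1 ((coset_rep g)^-1 * g).

Lemma val_coset_part g : val (coset_part g) = (coset_rep g)^-1 * g.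
Proof. exact: insubdK (coset_part_in g). Qed.

Lemma coset_partE g : coset_rep g * val (coset_part g) = g.
Proof. by rewrite val_coset_part mulVKg. Qed.

Lemma coset_part_mul g s : coset_part (g * val s) = coset_part g * s.
Proof. by apply: val_inj; rewrite valM !val_coset_part coset_rep_mul mulgA. Qed.

Lemma coset_rep_id g : coset_rep (coset_rep g) = coset_rep g.
Proof. by rewrite -[in RHS](coset_partE g) coset_rep_mul. Qed.

(** Cosets are encoded by their chosen representatives, which makes [G/S] a subtype of [G]. *)
Definition left_cosets := {k : G | coset_rep k == k}.

Definition to_coset g : left_cosets :=
  exist _ (coset_rep g) (introT eqP (coset_rep_id g)).

Lemma to_coset_mul g s : to_coset (g * val s) = to_coset g.
Proof. by apply: val_inj; exact: coset_rep_mul. Qed.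

Lemma coset_rep_left_coset (k : left_cosets) : coset_rep (val k) = val k.
Proof. exact: eqP (valP k). Qed.

Lemma to_cosetK (k : left_cosets) : to_coset (val k) = k.
Proof. by apply: val_inj; exact: coset_rep_left_coset. Qed.

Lemma coset_part_left_coset (k : left_cosets) : coset_part (val k) = 1.
Proof.
by apply: val_inj; rewrite val_coset_part val1 coset_rep_left_coset mulVg.
Qed.

(** Translations by [g] and by its inverse undo each other on [G/S], so a translation permutes the
    coordinates. *)
Lemma to_coset_transl g (k : left_cosets) :
  to_coset (g * val (to_coset (g^-1 * val k))) = k.
Proof.
rewrite -[RHS]to_cosetK -[in RHS](mulVKg g (val k)).
by rewrite -[in RHS](coset_partE (g^-1 * val k)) mulgA to_coset_mul.
Qed.

Context {d : measure_display} {X : measurableType d} {R : realType}.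
Variables (mu : probability X R) (T : S -> X -> X).
Hypothesis actT : measure_preserving_action mu T.
Local Notation Y := (power_space left_cosets X).

(* A point [y] of [Y] encodes the map [equivariant y : G -> X] which satisfies
   [equivariant y (g * s) = T s^-1 (equivariant y g)]; [G] acts on such maps by
   left translation. *)
Definition equivariant (y : Y) g : X := T (coset_part g)^-1 (y (to_coset g)).

Definition coinduced g (y : Y) : Y := fun k => equivariant y (g^-1 * val k).

Lemma equivariant_mul y g s :
  equivariant y (g * val s) = T s^-1 (equivariant y g).
Proof.
by rewrite /equivariant to_coset_mul coset_part_mul invgM (mpa_mul actT).
Qed.

Lemma equivariant_left_coset y (k : left_cosets) : equivariant y (val k) = y k.
Proof.
by rewrite /equivariant to_cosetK coset_part_left_coset invg1 (mpa_one actT).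
Qed.

(** At coset representatives this is the definition of [coinduced]; equivariance extends it to all
    of [G]. *)
Lemma equivariant_coinduced y g h :
  equivariant (coinduced g y) h = equivariant y (g^-1 * h).
Proof.
rewrite {1}/equivariant /coinduced -equivariant_mul -mulgA.
by rewrite coset_partE.
Qed.

Lemma coinduced1 y : coinduced 1 y = y.
Proof.
by apply/funext => k; rewrite /coinduced invg1 mul1g equivariant_left_coset.
Qed.

Lemma coinducedM g h y : coinduced (g * h) y = coinduced g (coinduced h y).
Proof.
apply/funext => k; rewrite /coinduced -/(coinduced h y) equivariant_coinduced.
by rewrite invgM mulgA.
Qed.

Lemma measurable_equivariant g :
  measurable_fun [set: Y] (equivariant ^~ g).
Proof.
exact: measurableT_comp (mpa_measurable actT _) (measurable_coordinate _).
Qed.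

Lemma measurable_coinduced g : measurable_fun [set: Y] (coinduced g).
Proof.
by apply: measurable_fun_power => k; exact: measurable_equivariant.
Qed.

Variable P : probability Y R.
Hypothesis P_rectangle : forall (s : seq left_cosets) (B : left_cosets -> set X),
  uniq s -> (forall k, measurable (B k)) ->
  P (rectangle s B) = (\prod_(k <- s) mu (B k))%E.

Let measurable_preimageT s A : measurable A -> measurable (T s @^-1` A).
Proof.
by move=> mA; rewrite -[X in measurable X]setTI; exact: (mpa_measurable actT).
Qed.

Lemma equivariant_preserving g (A : set X) :
  measurable A -> P ((equivariant ^~ g) @^-1` A) = mu A.
Proof.
move=> mA; rewrite -[RHS](mpa_preserving actT (coset_part g)^-1 mA).
have -> : (equivariant ^~ g) @^-1` A =
    rectangle [:: to_coset g] (fun=> T (coset_part g)^-1 @^-1` A).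
  apply/seteqP; split=> y; first by move=> yA k; rewrite inE => /eqP ->.
  by move=> /(_ (to_coset g) (mem_head _ _)).
by rewrite P_rectangle ?big_seq1//; move=> _; exact: measurable_preimageT.
Qed.

Lemma coinduced_preserving g (A : set Y) :
  measurable A -> P (coinduced g @^-1` A) = P A.
Proof.
pose U := HB.pack_for {mfun Y >-> Y} (coinduced g)
  (isMeasurableFun.Build _ _ _ _ _ (measurable_coinduced g)).
move: A; apply: (@eq_on_rectangles _ _ _ _ (distribution P U) P) => s B us mB.
(* Coordinate [k] of the translate is computed from coordinate [pi k] of [y]. A constraint [B k]
   thus becomes the constraint [C] at [pi k], a preimage of [B k] under a measure preserving map. *)
pose pi (k : left_cosets) := to_coset (g^-1 * val k).
pose piV (k : left_cosets) := to_coset (g * val k).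
have piK : cancel pi piV by move=> k; exact: to_coset_transl.
pose C j := T (coset_part (g^-1 * val (piV j)))^-1 @^-1` B (piV j).
have mC j : measurable (C j) by exact: measurable_preimageT.
transitivity (P (rectangle (map pi s) C)).
  congr (P _); apply/seteqP; split=> y yB k.
    by move=> /mapP[j js ->]; rewrite /C piK; exact: yB.
  move=> ks; have := yB (pi k); rewrite /C piK; apply.
  exact: map_f.
rewrite !P_rectangle//; last by rewrite (map_inj_uniq (can_inj piK)).
rewrite big_map; apply: eq_bigr => k _.
by rewrite /C piK (mpa_preserving actT).
Qed.

Lemma coinduced_action : measure_preserving_action P coinduced.
Proof.
split; [exact: measurable_coinduced|exact: coinduced_preserving|
        exact: coinduced1|exact: coinducedM].
Qed.

End coinduction.

(** * Transfer of the vdC property between the subgroup and the group *)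

Lemma vdC_set_overgroup (R : realType) (G : groupType) (Pr : {pred G})
    (S : subGroupType Pr) (H : set G) :
  H `<=` [set g : G | g \in Pr] `\` [set 1%g] ->
  vdC_set R ((val : S -> G) @^-1` H) -> vdC_set R H.
Proof.
move=> HS [_ vdCS]; split; first by move=> h /HS[].
move=> d X mu T f [mT pT T1 TM] foo Hf.
apply: (vdCS d X mu (fun s => T (val s)) f) => //; last first.
  by move=> s Hs; exact: Hf.
split=> [s|s A mA|x|s t x].
- exact: mT.
- exact: pT.
- by rewrite val1 T1.
- by rewrite valM TM.
Qed.

Lemma vdC_set_subgroup (R : realType) (G : groupType) (Pr : {pred G})
    (S : subGroupType Pr) (H : set G) :
  countable [set: G] -> H `<=` [set g : G | g \in Pr] ->
  vdC_set R H -> vdC_set R ((val : S -> G) @^-1` H).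
Proof.
move=> cG HS [H1 vdCG]; split.
  by move=> s /H1 s1 /= s1'; apply: s1; rewrite s1' val1.
move=> d X mu T f actT foo Hf.
have [e e_inj] : exists e : left_cosets Pr -> nat, injective e.
  have /pcard_injP[e e_inj] := cG.
  exists (fun k : left_cosets Pr => e (val k)) => k l ekl.
  by apply: val_inj; apply: e_inj => //; rewrite in_setT.
have [P P_rect] := infinite_product mu e_inj.
(* Evaluation at the identity; the vdC property in [G] will be applied to the lift of [f] along
   [p]. *)
pose p (y : power_space (left_cosets Pr) X) := equivariant T y 1%g.
have mp : measurable_fun setT p by exact: measurable_equivariant actT _.
have pp A : measurable A -> P (p @^-1` A) = mu A.
  exact: (equivariant_preserving actT P_rect).
have cf : cmeasurable f by case: foo.
rewrite -(cintegral_factor mp pp cf).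
apply: (vdCG _ _ P (coinduced T)).
- exact: (coinduced_action actT P_rect).
- exact: (cLinfty_factor mp pp).
move=> h Hh; have [s sh] : exists s : S, val s = h.
  by exists (Sub h (HS h Hh)); rewrite SubK.
have cfT : cmeasurable (fun x => f (T s x) * conjc (f x)).
  apply: cmeasurable_mul_conj => //.
  by apply: cmeasurable_comp cf _; exact: (mpa_measurable actT).
transitivity (cintegral mu (fun x => f (T s x) * conjc (f x))); last first.
  by apply: Hf; rewrite /preimage/= sh.
rewrite -(cintegral_factor mp pp cfT); congr (cintegral P _); apply/funext => y.
(* Equivariance of [p]: the translate by [s], evaluated at [1], is the value of [y] at the inverse
   of [s], which is [T s (p y)]. *)
rewrite /p (equivariant_coinduced actT) -sh.
by rewrite mulg1 -val_invg -[val s^-1%g]mul1g (equivariant_mul actT) invgK.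
Qed.

Theorem theorem6p5 (R : realType) (G : groupType) (P : {pred G})
    (S : subGroupType P) (H : set G) :
  countable [set: G] ->
  amenable R G ->
  H `<=` [set g : G | g \in P] `\` [set 1%g] ->
  (vdC_set R ((val : S -> G) @^-1` H) <-> vdC_set R H).
Proof.
move=> cG _ HS; split; first exact: vdC_set_overgroup.
by apply: vdC_set_subgroup => // h /HS[].
Qed.
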